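(* Every star-Lindelöf (respectively, strongly star-Lindelöf) space of cardinality less than $\mathrm{cov}(\mathcal{M})$ is star-Rothberger (respectively, strongly star-Rothberger).
   Context: A space is a topological space. $\mathrm{cov}(\mathcal{M})$ is the minimum cardinality of a family of meager subsets of $\mathbb{R}$ that covers $\mathbb{R}$; equivalently, the minimum cardinality of a set $F\subseteq\mathbb{N}^{\mathbb{N}}$ such that for every $g\in\mathbb{N}^{\mathbb{N}}$ there is an $f\in F$ with $f(n)\neq g(n)$ for all but finitely many $n$. For $A\subseteq X$ and a collection $\mathcal{P}$ of subsets of $X$, $St(A,\mathcal{P})=\bigcup\{B\in\mathcal{P} : A\cap B\neq\emptyset\}$, and $St(x,\mathcal{P})=St(\{x\},\mathcal{P})$. A space $X$ is: - star-Lindelöf if for every open cover $\mathcal{U}$ of $X$ there is a countable $\mathcal{V}\subseteq\mathcal{U}$ with $St(\bigcup\mathcal{V},\mathcal{U})=X$; - strongly star-Lindelöf if for every open cover $\mathcal{U}$ of $X$ there is a countable set $K\subseteq X$ with $St(K,\mathcal{U})=X$; - star-Rothberger if for each sequence $(\mathcal{U}_n)_{n\in\mathbb{N}}$ of open covers of $X$ there is a sequence $(V_n)$ with $V_n\in\mathcal{U}_n$ for each $n$ such that $\{St(V_n,\mathcal{U}_n) : n\in\mathbb{N}\}$ is an open cover of $X$; - strongly star-Rothberger if for each sequence $(\mathcal{U}_n)_{n\in\mathbb{N}}$ of open covers of $X$ there is a sequence $(x_n)$ of points of $X$ such that $\{St(x_n,\mathcal{U}_n) : n\in\mathbb{N}\}$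 is an open cover of $X$. *)

(* Defs.v *)
From mathcomp Require Import all_boot all_order all_algebra.
From mathcomp Require Import all_classical all_reals topology normedtype.

Set Implicit Arguments.
Unset Strict Implicit.
Unset Printing Implicit Defensive.

Import numFieldNormedType.Exports.
Local Open Scope classical_set_scope.
Local Open Scope card_scope.

Definition open_cover (X : topologicalType) (U : set (set X)) : Prop :=
  (forall B, U B -> open B) /\ \bigcup_(B in U) B = [set: X].

Definition star (X : Type) (A : set X) (P : set (set X)) : set X :=
  \bigcup_(B in [set B | P B /\ A `&` B !=set0]) B.

Definition star_Lindelof (X : topologicalType) : Prop :=
  forall U : set (set X), open_cover U ->
    exists V : set (set X),
      [/\ V `<=` U, countable V & star (\bigcup_(B in V) B) U = [set: X]].

Definition strongly_star_Lindelof (X : topologicalType) : Prop :=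
  forall U : set (set X), open_cover U ->
    exists K : set X, countable K /\ star K U = [set: X].

Definition star_Rothberger (X : topologicalType) : Prop :=
  forall U : nat -> set (set X), (forall n, open_cover (U n)) ->
    exists V : nat -> set X,
      (forall n, U n (V n)) /\ open_cover (range (fun n => star (V n) (U n))).

Definition strongly_star_Rothberger (X : topologicalType) : Prop :=
  forall U : nat -> set (set X), (forall n, open_cover (U n)) ->
    exists x : nat -> X, open_cover (range (fun n => star [set x n] (U n))).

Definition nowhere_dense (X : topologicalType) (A : set X) : Prop :=
  interior (closure A) = set0.

Definition meager (X : topologicalType) (A : set X) : Prop :=
  exists F : nat -> set X,
    (forall n, nowhere_dense (F n)) /\ A = \bigcup_n F n.

Definition meager_cover (X : topologicalType) (F : set (set X)) : Prop :=
  (forall A, F A -> meager A) /\ \bigcup_(A in F) A = [set: X].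

(* There is no type of cardinal numbers: the cardinal cov(M) is represented by
   an arbitrary set K of that cardinality. *)
Definition has_card_covM (R : realType) (T : Type) (K : set T) : Prop :=
  exists F : set (set R),
    [/\ meager_cover F,
        forall G : set (set R), meager_cover G -> F #<= G
      & K #= F].

Definition card_lt (T U : Type) (A : set T) (B : set U) : Prop :=
  A #<= B /\ ~ (B #<= A).

(* Main.v *)
(** The reals carry a sequence of maps [digit n : R -> nat] such that [digit n]
    takes every value on an open piece of every interval of length [> 2/(n+1)].
    Hence for each [f : nat -> nat] the reals with [digit n r <> f n] for all [n]
    form a nowhere dense set, and fewer than cov(M) functions [f] are all met
    somewhere by a single sequence [n |-> digit n r].  For each cover in the
    sequence, the (strong) star-Lindelöf property attaches to every point a
    function naming, for each [n], a member of a countable list whose star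
    contains that point; one [g] meeting all these functions is the required
    selection. *)
Require Import Defs.
From mathcomp Require Import all_boot all_order all_algebra.
From mathcomp Require Import all_classical all_reals topology normedtype.
From mathcomp Require Import lra.

Import Order.TTheory GRing.Theory Num.Theory numFieldNormedType.Exports.
Local Open Scope classical_set_scope.

Section Digits.
Local Open Scope ring_scope.
Context {R : realType}.

(** This is the first continued fraction digit of the fractional part of [(n+1) r], shifted to start
    at 0. When that part is 0, the convention [0^-1 = 0] yields the digit 0. *)
Definition digit (n : nat) (r : R) : nat :=
  (Num.truncn (n.+1%:R * r - (Num.floor (n.+1%:R * r))%:~R)^-1).-1.

(** Strict bounds suffice: only an open piece with digit [k] is wanted. *)
Lemma digit_eq (n k : nat) (m : int) (r : R) :
  k.+2%:R^-1 < n.+1%:R * r - m%:~R < k.+1%:R^-1 -> digit n r = k.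
Proof.
move=> /andP[lo hi]; rewrite /digit.
have k2 : 0 < k.+2%:R^-1 :> R by rewrite invr_gt0.
have k1 : k.+1%:R^-1 <= 1 :> R by rewrite invf_le1 // ler1n.
have -> : Num.floor (n.+1%:R * r) = m.
  apply: floor_def; rewrite intrD mulr1z.
  move: (n.+1%:R * r) (m%:~R) (k.+2%:R^-1) (k.+1%:R^-1) lo hi k2 k1.
  by move=> y d a b *; apply/andP; split; lra.
have t0 := lt_trans k2 lo.
rewrite (@truncn_def _ _ k.+1) //; apply/andP; split.
  by rewrite -[leLHS]invrK lef_pV2 ?posrE ?invr_gt0 // ltW.
by rewrite -[ltRHS]invrK ltf_pV2 ?posrE ?invr_gt0.
Qed.

Lemma digit_avoiding_meager (f : nat -> nat) :
  meager [set r : R | forall n, digit n r <> f n].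
Proof.
(* [E] is itself nowhere dense, so a constant sequence will do. *)
set E := [set r | _]; exists (fun=> E); split; last first.
  by rewrite bigcup_const //; exists 0%N.
move=> _; apply/seteqP; split => // x /= /nbhs_ballP[e /= e0 xE].
(* With [1/N < e], the cell [[m/N, (m+1)/N)] around [x] fits in the ball. *)
pose n := Num.truncn e^-1; pose k := f n; pose N : R := n.+1%:R.
pose m := Num.floor (N * x).
have N0 : 0 < N by rewrite ltr0n.
have Ne : N^-1 < e.
  by rewrite -[ltRHS]invrK ltf_pV2 ?posrE ?invr_gt0 // truncnS_gt.
pose a : R := k.+2%:R^-1; pose b : R := k.+1%:R^-1.
have a0 : 0 < a by rewrite invr_gt0.
have ab : a < b by rewrite ltf_pV2 ?posrE // ltr_nat.
have b1 : b <= 1 by rewrite invf_le1 // ler1n.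
have /andP[mx xm] := floor_itv (N * x); rewrite -/m intrD mulr1z in mx xm.
(* The midpoint of the piece of this cell where digit [n] equals [f n]; as [y] lies in the closure
   of [E], that piece would meet [E]. *)
pose y := (m%:~R + (a + b) / 2) / N.
have Ny : N * y = m%:~R + (a + b) / 2 by rewrite mulrC divfK ?gt_eqF.
have /xE : ball x e y.
  rewrite -ball_normE /=; apply: lt_trans Ne.
  rewrite -(ltr_pM2l N0) mulfV ?gt_eqF // -[X in X * _]gtr0_norm // -normrM.
  by rewrite mulrBr Ny ltr_norml; apply/andP; split; lra.
have yJ : y \in `](m%:~R + a) / N, (m%:~R + b) / N[.
  by rewrite in_itv /= !ltr_pM2r ?invr_gt0 //; apply/andP; split; lra.
move=> /(_ _ (near_in_itvoo yJ)) [z [Ez]] /=.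
rewrite in_itv /= ltr_pdivrMr // ltr_pdivlMr // => /andP[z1 z2].
apply: (Ez n); apply: (digit_eq n (f n) m).
by rewrite -/N -/a -/b mulrC; apply/andP; split; lra.
Qed.

End Digits.

(** To be used with [P n k x] meaning that the star of the [k]-th candidate for the [n]-th cover
    contains [x]. *)
Lemma small_family_selection {R : realType} {T : Type} {covM : set T}
    {X : Type} (P : nat -> nat -> X -> Prop) :
  has_card_covM R covM -> card_lt [set: X] covM ->
  (forall n x, exists k, P n k x) ->
  exists g : nat -> nat, forall x, exists n, P n (g n) x.
Proof.
move=> [F [_ Fmin KF]] [_ KX] Pex.
have [f Pf] : {f : X -> nat -> nat & forall x n, P n (f x n) x}.
  exists (fun x n => projT1 (cid (Pex n x))) => x n.
  exact: projT2 (cid (Pex n x)).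
pose E x := [set r : R | forall n, digit n r <> f x n].
have [[r Er]|cov] := pselect (exists r, forall x, ~ E x r).
  exists (digit^~ r) => x.
  by have /existsNP[n /contrapT rn] := Er x; exists n; rewrite rn.
(* Otherwise the sets [E x] form a meager cover of the reals indexed by [X], so cov(M) is at most
   the size of [X]. *)
exfalso; apply: KX; rewrite (card_le_eql KF).
apply: card_le_trans (card_image_le E setT); apply: Fmin; split.
  by move=> _ [x _ <-]; exact: digit_avoiding_meager.
apply/seteqP; split => // r _.
have /forallNP/(_ r)/existsNP[x /contrapT Exr] := cov.
by exists (E x) => //; exists x.
Qed.

Lemma countable_range {Y : Type} {A : set Y} :
  countable A -> A !=set0 -> exists e : nat -> Y, range e = A.
Proof.
move=> /pfcard_geP[->[y []]|[e] _].
by exists e; apply: image_eq.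
Qed.

Lemma star_open_cover {X : topologicalType} (U : nat -> set (set X))
    (A : nat -> set X) :
  (forall n, open_cover (U n)) ->
  (forall x, exists n, star (A n) (U n) x) ->
  open_cover (range (fun n => star (A n) (U n))).
Proof.
move=> Uc Ax; split.
  by move=> _ [n _ <-]; apply: bigcup_open => B [/(Uc n).1].
apply/seteqP; split => // x _; have [n Anx] := Ax x.
by exists (star (A n) (U n)) => //; exists n.
Qed.

Theorem theorem4p3 (R : realType) (T : Type) (covM : set T)
    (hcovM : has_card_covM R covM)
    (X : topologicalType) (X_nonempty : [set: X] !=set0)
    (X_small : card_lt [set: X] covM) :
  (star_Lindelof X -> star_Rothberger X) /\
  (strongly_star_Lindelof X -> strongly_star_Rothberger X).
Proof.
have [x0 _] := X_nonempty; split => SL U Uc.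
- have /choice[e He] n : exists e : nat -> set X, (forall k, U n (e k)) /\
      forall x, exists k, star (e k) (U n) x.
    have [V [VU cV SV]] := SL _ (Uc n).
    (* The star of a union is the union of the stars. *)
    have starV x : exists2 B, V B & star B (U n) x.
      have : star (\bigcup_(B in V) B) (U n) x by rewrite SV.
      by move=> [C [UC [y [[B VB By] Cy]]] Cx]; exists B => //;
        exists C => //; split => //; exists y.
    (* The point [x0] makes [V] nonempty, so a sequence, possibly with repetitions, lists it. *)
    have [|e eV] := countable_range cV.
      by have [B VB _] := starV x0; exists B.
    exists e; split=> [k|x]; first by apply: VU; rewrite -eV; exists k.
    by have [B] := starV x; rewrite -eV => -[k _ <-]; exists k.
  have [g Hg] := small_family_selection _ hcovM X_small (fun n => (He n).2).
  exists (fun n => e n (g n)); split => [n|]; first exact: (He n).1.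
  exact: star_open_cover.
- have /choice[e He] n : exists e : nat -> X,
      forall x, exists k, star [set e k] (U n) x.
    have [K [cK SK]] := SL _ (Uc n).
    (* Likewise, the star of [K] is the union of the stars of its points. *)
    have starK x : exists2 y, K y & star [set y] (U n) x.
      have : star K (U n) x by rewrite SK.
      by move=> [C [UC [y [Ky Cy]]] Cx]; exists y => //;
        exists C => //; split => //; exists y.
    have [|e eK] := countable_range cK.
      by have [y Ky _] := starK x0; exists y.
    by exists e => x; have [y] := starK x; rewrite -eK => -[k _ <-]; exists k.
  have [g Hg] := small_family_selection _ hcovM X_small He.
  exists (fun n => e n (g n)).
  exact: (star_open_cover U (fun n => [set e n (g n)])).
Qed.
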